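(* Let $g$ be a piecewise constant function on $[0,1]$ and $f=K*g$, where $K$ is a convolution kernel on $\mathbb R$ that is symmetric, compactly supported, nonnegative, positive in a neighborhood of the origin, and of total mass $1$. If the support size $\kappa$ of $K$ satisfies $$\kappa\le\frac{h_{\min}\,l_{\min}}{2(8h_{\max}+h_{\min})},$$ then $g$ is the unique minimizer of the Potts functional $P_\gamma$ associated with $f$, i.e. $g$ is the unique element with $$P_\gamma(g)=\inf_{u\in\mathrm{PC}[0,1]}P_\gamma(u)=\inf_{u\in\mathrm{PC}[0,1]}\ \gamma J(u)+\|u-f\|_1,$$ for any Potts parameter $\gamma$ satisfying $$2\kappa h_{\max}\le\gamma\le\tfrac12h_{\min}l_{\min}-(h_{\min}+6h_{\max})\,\kappa.$$
   Context: $\mathrm{PC}[0,1]\subset L^1[0,1]$ is the set of (equivalence classes of) piecewise constant functions on $[0,1]$ with finitely many jumps, $J(u)$ is the number of jumps of $u$ in $(0,1)$, and $P_\gamma(u)=\gamma J(u)+\|u-f\|_1$ (norm of $L^1[0,1]$) for $u\in\mathrm{PC}[0,1]$. To define $K*g$, $g$ is extended to the left of $0$ and to the right of $1$ by its value on the leftmost and rightmost interval, respectively. The support size $\kappa>0$ of $K$ is the half-width of its support, i.e. $\operatorname{supp}K\subset[-\kappa,\kappa]$. For $g$ with jump locations $0<j_1<\dots<j_n<1$, $h_{\min}$ and $h_{\max}$ denote the minimal and maximal jump height (absolute value of the jump) of $g$, and $l_{\min}$ denotes the minimal length of the intervals of the partition $0<j_1<\dots<j_n<1$ of $[0,1]$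 (boundary intervals included). If $g$ is constant, these quantities are not defined, and the statement is understood with the constraints on $\kappa$ and $\gamma$ void, with $\gamma>0$ arbitrary. *)

(* Defs.v *)
From HB Require Import structures.
From mathcomp Require Import all_boot all_order all_algebra.
From mathcomp Require Import finmap.
From mathcomp Require Import all_classical all_reals all_analysis.

Set Implicit Arguments.
Unset Strict Implicit.
Unset Printing Implicit Defensive.

Import Order.TTheory GRing.Theory Num.Theory.
Import numFieldNormedType.Exports.

Local Open Scope classical_set_scope.
Local Open Scope ring_scope.

Section Potts.
Variable R : realType.
Local Notation mu := (@lebesgue_measure R).

(* Elements of PC[0,1] are handled through representatives R -> R: values at
   the points of the partition and outside [0, 1] are arbitrary, and all the
   notions below depend only on the class of u modulo a.e. equality on
   [0, 1]. Every class has such a representative. *)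
Definition piecewise_constant : set (R -> R) :=
  [set u | exists2 p : seq R, itv_partition 0 1 p &
     forall i, (i < size p)%N ->
       exists c, forall x, x \in `](0 :: p)`_i, p`_i[ -> u x = c].

(* The limits are over punctured one-sided neighborhoods of t. *)
Definition lval (u : R -> R) (t : R) : R := lim (u x @[x --> t^'-]).
Definition rval (u : R -> R) (t : R) : R := lim (u x @[x --> t^'+]).

Definition jump_set (u : R -> R) : set R :=
  [set t | 0 < t < 1 /\ lval u t <> rval u t].

(* j_1 < ... < j_n; jump_set u is finite when u is piecewise constant
   (fset_set is the junk value fset0 on infinite sets). *)
Definition jumps (u : R -> R) : seq R := sort <=%R (fset_set (jump_set u)).

Definition nb_jumps (u : R -> R) : nat := size (jumps u).

Definition jump_heights (u : R -> R) : seq R :=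
  [seq `|rval u t - lval u t| | t <- jumps u].

Definition interval_lengths (u : R -> R) : seq R :=
  pairmap (fun x y => y - x) 0 (rcons (jumps u) 1).

(* Minimum and maximum of a nonempty sequence (0 for the empty one). *)
Definition seq_min (s : seq R) : R := \big[Num.min/head 0 s]_(x <- s) x.
Definition seq_max (s : seq R) : R := \big[Num.max/head 0 s]_(x <- s) x.

Definition h_min (u : R -> R) : R := seq_min (jump_heights u).
Definition h_max (u : R -> R) : R := seq_max (jump_heights u).
Definition l_min (u : R -> R) : R := seq_min (interval_lengths u).

Definition pc_extension (u : R -> R) : R -> R := fun x =>
  if x < 0 then rval u 0 else if 1 < x then lval u 1 else u x.

Definition convolution (K u : R -> R) : R -> R := fun x =>
  \int[mu]_(y in setT) (K y * u (x - y)).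

Definition supp (K : R -> R) : set R := closure [set x | K x != 0].

Record convolution_kernel (K : R -> R) : Prop := ConvolutionKernel {
  kernel_integrable : mu.-integrable setT (EFin \o K) ;
  kernel_symmetric : forall x, K (- x) = K x ;
  kernel_compact : compact (supp K) ;
  kernel_ge0 : forall x, 0 <= K x ;
  kernel_pos : \forall x \near 0, 0 < K x ;
  kernel_mass : \int[mu]_(x in setT) K x = 1 }.

Definition potts (gamma : R) (f u : R -> R) : \bar R :=
  ((gamma *+ nb_jumps u)%:E + \int[mu]_(x in `[0%R, 1%R]) `|u x - f x|%:E)%E.

Definition ae_eq01 (u v : R -> R) : Prop :=
  {ae mu, forall x, x \in `[0, 1] -> u x = v x}.

End Potts.

(* Main.v *)
(** Let [theta] be the cumulative mass of [K]. Convolution with [K] turns a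
    jump at [t] into the profile [theta (x - t)], so [f = K * g] equals [g]
    except within distance [kappa] of a jump. Put a window of length [l_min]
    around each jump of [g], of height [h] say; these windows are disjoint, and
    [u] is compared with [g] on each of them.
    - If [u] has no jump in the window, it costs at least
      [(l_min / 2 - 2 * kappa) * h] more in [L^1] norm than [g], which exceeds
      the [gamma] it saves.
    - If [u] has two or more jumps there, it pays at least [gamma] too much and
      saves at most [kappa * h < gamma].
    - If [u] has exactly one jump there, its error is at least that of [g]: the
      values of [g] dominate the window on either side and so are the medians
      of [f], and displacing the jump increases the error because
      [theta < 1 / 2] to the left of [0].
    Outside the windows [g = f], so [u] cannot do better there. *)
Require Import Defs.
From mathcomp Require Import all_boot all_order all_algebra finmap.
From mathcomp Require Import all_classical all_reals all_analysis.
From mathcomp Require Import measurable_realfun.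
From mathcomp Require Import ring lra.

Set Implicit Arguments.
Unset Strict Implicit.
Unset Printing Implicit Defensive.

Import Order.TTheory GRing.Theory Num.Theory.
Import numFieldNormedType.Exports.

Local Open Scope classical_set_scope.
Local Open Scope ring_scope.

(** * Piecewise constant functions as sums of jumps *)

Section PiecewiseConstant.
Variable R : realType.
Implicit Types (c a b t x : R) (h phi u : R -> R) (p s : seq R).

(* With [phi] the Heaviside function this is a step function, with [phi] the
   cumulative mass of the kernel it is its convolution. *)
Definition jump_sum phi c h s x : R := c + \sum_(t <- s) h t * phi (x - t).

Definition heaviside x : R := (0 < x)%R%:R.

Lemma heaviside_sub x t : heaviside (x - t) = (t < x)%R%:R.
Proof. by rewrite /heaviside subr_gt0. Qed.

(** Induction on the partition: passing its first point [y] changes the constant from [c] to [c'],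
    so [y] gets the coefficient [c' - c]. The end point [b] gets one too, but its term vanishes
    before [b]. *)
Lemma itv_partition_step a b p u : itv_partition a b p ->
  (forall i, (i < size p)%N ->
    exists c, forall x, x \in `](a :: p)`_i, p`_i[ -> u x = c) ->
  exists c h, forall x, a < x < b -> x \notin p ->
    u x = jump_sum heaviside c h p x.
Proof.
elim: p a => [|y p IH] a.
  by move=> /itv_partition_nil-> _; exists 0, id => x; lra.
move=> [/= /andP[ay yp] lp] H.
have [||c' [h' h'E]] := IH y; first by split.
  by move=> i ip; have [c cE] := H i.+1 ip; exists c.
have [c cE] := H 0%N isT; rewrite /= in cE.
have py : {in p, forall z, y < z}.
  move=> z zp; have /allP := order_path_min lt_trans yp; exact.
have yNp : y \notin p by apply/negP => /py; rewrite ltxx.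
exists c, (fun z => if z == y then c' - c else h' z) => x axb.
rewrite in_cons negb_or => /andP[xy xp].
rewrite /jump_sum big_cons eqxx.
rewrite (eq_big_seq (fun z => h' z * heaviside (x - z))); last first.
  move=> z zp; case: eqP => // zy; by rewrite -zy zp in yNp.
have [xlt|ylt|xE] := ltgtP x y; last by rewrite xE eqxx in xy.
  rewrite heaviside_sub (lt_gtF xlt) mulr0 add0r big1_seq ?addr0.
    by apply: cE; rewrite in_itv/=; lra.
  by move=> z /= zp; rewrite heaviside_sub (lt_gtF (lt_trans xlt (py z zp))) mulr0.
rewrite heaviside_sub ylt h'E ?ylt//=; last lra.
by rewrite /jump_sum mulr1 addrA subrKC.
Qed.

(** Finitely many points leave a gap just after [t]; a step function is constant there, which yields
    its one-sided limit. *)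
Lemma near_right_seq t s : \forall x \near t^'+, {in s, forall y, y <= t \/ x < y}.
Proof.
elim: s => [|z s IH]; first by near=> x.
have [zt|tz] := leP z t.
  near=> x => y; rewrite in_cons => /predU1P[->|]; first by left.
  move: y; near: x; exact: IH.
near=> x => y; rewrite in_cons => /predU1P[->|].
  right; near: x; exact: nbhs_right_lt.
move: y; near: x; exact: IH.
Unshelve. all: by end_near. Qed.

Lemma near_left_seq t s : \forall x \near t^'-, {in s, forall y, t <= y \/ y < x}.
Proof.
elim: s => [|z s IH]; first by near=> x.
have [tz|zt] := leP t z.
  near=> x => y; rewrite in_cons => /predU1P[->|]; first by left.
  move: y; near: x; exact: IH.
near=> x => y; rewrite in_cons => /predU1P[->|].
  right; near: x; exact: nbhs_left_gt.
move: y; near: x; exact: IH.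
Unshelve. all: by end_near. Qed.

Section OneSidedLimits.
Variables (a b c : R) (h u : R -> R) (p : seq R).
Hypothesis uE : forall x, a < x < b -> x \notin p ->
  u x = jump_sum heaviside c h p x.

(** The sum has [y <= t] here and [y < t] in [lval_step]: their difference is the coefficient at
    [t]. *)
Lemma rval_step t : a <= t < b ->
  rval u t = c + \sum_(y <- p) h y * (y <= t)%R%:R.
Proof.
move=> /andP[at_ tb]; apply: lim_near_cst => //.
near=> x.
have tx : t < x by near: x; exact: nbhs_right_gt.
have xb : x < b by near: x; exact: nbhs_right_lt.
have H : {in p, forall y, y <= t \/ x < y} by near: x; exact: near_right_seq.
rewrite uE ?(le_lt_trans at_ tx)//.
  rewrite /jump_sum; congr (_ + _); apply: eq_big_seq => y /H yH.
  rewrite heaviside_sub; congr (_ * _%:R); congr nat_of_bool.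
  by apply/idP/idP; lra.
by apply/negP => /H; lra.
Unshelve. all: by end_near. Qed.

Lemma lval_step t : a < t <= b ->
  lval u t = c + \sum_(y <- p) h y * (y < t)%R%:R.
Proof.
move=> /andP[at_ tb]; apply: lim_near_cst => //.
near=> x.
have tx : x < t by near: x; exact: nbhs_left_lt.
have xb : a < x by near: x; exact: nbhs_left_gt.
have H : {in p, forall y, t <= y \/ y < x} by near: x; exact: near_left_seq.
rewrite uE ?xb ?(lt_le_trans tx tb)//.
  rewrite /jump_sum; congr (_ + _); apply: eq_big_seq => y /H yH.
  rewrite heaviside_sub; congr (_ * _%:R); congr nat_of_bool.
  by apply/idP/idP; lra.
by apply/negP => /H; lra.
Unshelve. all: by end_near. Qed.

End OneSidedLimits.

(** Passes from an arbitrary partition to the intrinsic jumps of [u]. The formula holds on the whole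
    line because extension by the boundary values adds no jump at 0 or 1. *)
Lemma pc_extension_step u : piecewise_constant u ->
  exists c (E : seq R),
  [/\ sorted <%R (jumps u),
      {in jumps u, forall t, 0 < t < 1 /\ rval u t - lval u t != 0} &
      forall x, x \notin E -> pc_extension u x =
        jump_sum heaviside c (fun t => rval u t - lval u t) (jumps u) x].
Proof.
move=> [p part /(itv_partition_step part)[c [h uE]]].
have [pp /eqP lp] := part.
have pgt0 : {in p, forall y, 0 < y}.
  move=> z zp; have /allP := order_path_min lt_trans pp; exact.
have ple1 : {in p, forall y, y <= 1}.
  move=> z zp; rewrite -(nth_index 1 zp).
  have /(_ (index z p).+1) := fun m hm => @itv_partition_nth_le _ R 0 1 p m hm part.
  by rewrite ltnS index_mem => /(_ zp).
have up : uniq p by apply: (sorted_uniq lt_trans ltxx); exact: path_sorted pp.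
have hE t : 0 < t < 1 -> rval u t - lval u t = if t \in p then h t else 0.
  move=> t01; rewrite (rval_step uE) ?(lval_step uE); try lra.
  rewrite opprD addrACA subrr add0r -sumrB.
  rewrite (eq_bigr (fun y => if y == t then h y else 0)); last first.
    by move=> y _; rewrite -mulrBr; case: ltgtP => _; rewrite ?subrr ?subr0 ?mulr0 ?mulr1.
  rewrite -big_mkcond /= -big_filter; case: ifPn => tp.
    have -> : [seq i <- p | i == t] = [:: t].
      have /= := filter_pred1_uniq up tp.
      by [].
    by rewrite big_seq1.
  by rewrite big1_seq// => y; rewrite mem_filter => /andP[_ /andP[/eqP-> tp']]; rewrite tp' in tp.
have jsub : jump_set u `<=` [set` p].
  move=> t [t01 /eqP]; rewrite eq_sym -subr_eq0 hE//= ; by case: ifP; rewrite ?eqxx.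
have jfin : finite_set (jump_set u) by apply: sub_finite_set jsub _; exact: finite_seq.
have memj t : (t \in jumps u) = (t \in jump_set u).
  by rewrite /jumps mem_sort in_fset_set.
have js : sorted <%R (jumps u).
  rewrite lt_sorted_uniq_le sort_uniq fset_uniq /=.
  by apply: sort_sorted; exact: le_total.
have jP : {in jumps u, forall t, 0 < t < 1 /\ rval u t - lval u t != 0}.
  move=> t; rewrite memj inE => -[t01 /eqP]; rewrite eq_sym -subr_eq0; by [].
(* Partition points need not be jumps: those with coefficient 0 are dropped, and so is the end point
   1. *)
have jperm : perm_eq (jumps u) [seq t <- p | (t < 1) && (h t != 0)].
  apply: uniq_perm; [by rewrite sort_uniq fset_uniq | by rewrite filter_uniq|].
  move=> t; rewrite mem_filter; apply/idP/idP.
    move=> /jP[t01]; rewrite hE//; case: ifP; rewrite ?eqxx// => _ ->.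
    by case/andP: t01 => _ ->.
  move=> /andP[/andP[t1 ht] tp]; rewrite memj inE; split; first by rewrite t1 pgt0.
  by apply/eqP; rewrite eq_sym -subr_eq0 hE ?tp// t1 pgt0.
(* The end point 1 is in [p] but is not a jump, so the weight must vanish there. *)
have sumE (w : R -> R) : (w 1 = 0) ->
    \sum_(t <- jumps u) (rval u t - lval u t) * w t = \sum_(t <- p) h t * w t.
  move=> w1; rewrite (perm_big _ jperm) big_filter big_mkcond /=.
  apply: eq_big_seq => t tp.
  have := ple1 t tp; rewrite le_eqVlt => /predU1P[->|t1].
    by rewrite ltxx /= w1 mulr0.
  rewrite hE ?tp ?t1 ?pgt0//=; by case: eqP => //= ->; rewrite mul0r.
have r0 : rval u 0 = c.
  rewrite (rval_step uE) ?lexx ?ltr01// big1_seq ?addr0// => y /= /pgt0 y0.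
  by rewrite leNgt y0 mulr0.
have l1 : lval u 1 = c + \sum_(t <- jumps u) (rval u t - lval u t).
  rewrite (lval_step uE) ?lexx ?ltr01//.
  rewrite -(sumE (fun t => (t < 1)%R%:R)) ?ltxx//; congr (_ + _).
  by apply: eq_big_seq => t /jP[/andP[_ ->] _]; rewrite mulr1.
(* The values of [u] at the partition points are arbitrary, and 0 is the only one of them outside
   [p]. *)
exists c, (0 :: p); split=> // x; rewrite in_cons negb_or => /andP[x0 xp].
rewrite /pc_extension; case: ltP => [xlt0|x0'].
  rewrite r0 /jump_sum big1_seq ?addr0// => t /= /jP[/andP[t0 _] _].
  by rewrite heaviside_sub (lt_gtF (lt_trans xlt0 t0)) mulr0.
case: ltP => [x1|x1].
  rewrite l1 /jump_sum; congr (_ + _); apply: eq_big_seq => t /jP[/andP[_ t1] _].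
  by rewrite heaviside_sub (lt_trans t1 x1) mulr1.
have x1' : x < 1.
  rewrite lt_neqAle x1 andbT; apply: contra xp => /eqP ->.
  rewrite -{1}lp; case: p lp {part pp uE pgt0 ple1 up hE jsub jperm sumE} => [/= l|y p _ /=].
    by move: (@ltr01 R); rewrite -l ltxx.
  exact: mem_last.
rewrite uE//; last by rewrite x1' andbT lt_neqAle eq_sym x0.
rewrite /jump_sum; congr (_ + _).
rewrite (sumE (fun t => heaviside (x - t)))// heaviside_sub.
by rewrite (lt_gtF x1').
Qed.

End PiecewiseConstant.

(** * Integrals over compact intervals *)

Section Integrals.
Variable R : realType.
Local Notation mu := (@lebesgue_measure R).
Implicit Types (a b c x : R) (f g phi h : R -> R) (s E : seq R).

Let mI a b : measurable (`[a, b]%classic : set (measurableTypeR R)).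
Proof. exact: measurable_itv. Qed.

Definition integrable_on a b f := mu.-integrable `[a, b] (EFin \o f).

Lemma integrable_onS a b a' b' f : a <= a' -> b' <= b ->
  integrable_on a b f -> integrable_on a' b' f.
Proof.
move=> aa bb; apply: integrableS => //; apply: subset_itv; by rewrite bnd_simp.
Qed.

Lemma Rintegral_split a b c f : a <= b -> b <= c -> integrable_on a c f ->
  \int[mu]_(x in `[a, c]) f x =
  \int[mu]_(x in `[a, b]) f x + \int[mu]_(x in `[b, c]) f x.
Proof.
move=> ab bc fi.
have := Rintegral_itvB (x := b) fi; rewrite !bnd_simp => /(_ ab bc).
rewrite Rintegral_itv_obnd_cbnd; first by move=> <-; rewrite addrC subrK.
by apply: integrableS fi => //; apply: subset_itv; rewrite ?bnd_simp.
Qed.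

(** A monotone function is bounded on a compact interval by its values at the end points. This
    serves both [heaviside] and the cumulative mass. *)
Lemma integrable_on_nondecreasing a b f :
  nondecreasing_fun f -> integrable_on a b f.
Proof.
move=> fnd; apply: measurable_bounded_integrable => //.
- rewrite [X in (X < _)%E](_ : _ = mu `[a, b]%classic)// lebesgue_measure_itv/=.
  by case: ifP => _; rewrite -?EFinB ltry.
- exact: nondecreasing_measurable.
exists (`|f a| + `|f b|); split; first exact: num_real.
move=> M hM x /=; rewrite in_itv/= => /andP[ax xb].
have := fnd _ _ ax; have := fnd _ _ xb.
rewrite ler_norml.
move: (ler_norm (f b)) (ler_norm (- f a)) (normr_ge0 (f b)) (normr_ge0 (f a)).
rewrite normrN; lra.
Qed.

(** End points are null sets; they are left out because the local formulas for f and g hold on open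
    windows. *)
Lemma Rintegral_ge_cst a b m f : a <= b -> integrable_on a b f ->
  (forall x, a < x < b -> m <= f x) ->
  m * (b - a) <= \int[mu]_(x in `[a, b]) f x.
Proof.
move=> ab fi fm.
have fio : mu.-integrable `]a, b[ (EFin \o f).
  by apply: integrableS fi => //; apply: subset_itv; rewrite ?bnd_simp.
rewrite -Rintegral_itv_bndo_bndc; last first.
  by apply: integrableS fi => //; apply: subset_itv; rewrite ?bnd_simp.
rewrite -Rintegral_itv_obnd_cbnd//.
have mE : fine (mu `]a, b[) = b - a.
  rewrite lebesgue_measure_itv/= lte_fin; case: ltP => //= ba.
  apply/eqP; rewrite eq_sym subr_eq0; apply/eqP/le_anti; lra.
rewrite -mE -Rintegral_cst//; apply: le_Rintegral => //.
have : integrable_on a b (cst m) by exact: integrable_on_nondecreasing.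
by apply: integrableS => //; apply: subset_itv; rewrite ?bnd_simp.
Qed.

Lemma Rintegral_itv_eq0 a b f : integrable_on a b f ->
  (forall x, a < x < b -> f x = 0) -> \int[mu]_(x in `[a, b]) f x = 0.
Proof.
move=> fi f0.
rewrite -Rintegral_itv_bndo_bndc; last first.
  by apply: integrableS fi => //; apply: subset_itv; rewrite ?bnd_simp.
rewrite -Rintegral_itv_obnd_cbnd; last first.
  by apply: integrableS fi => //; apply: subset_itv; rewrite ?bnd_simp.
rewrite /Rintegral integral0_eq// => x /=; rewrite in_itv/= => xab.
by rewrite f0.
Qed.

Lemma jump_sum_cons phi c h t s x :
  jump_sum phi c h (t :: s) x = h t * phi (x - t) + jump_sum phi c h s x.
Proof. by rewrite /jump_sum big_cons addrCA. Qed.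

Lemma integrable_on_jump_sum a b phi c h s :
  nondecreasing_fun phi -> integrable_on a b (jump_sum phi c h s).
Proof.
move=> phind; elim: s => [|t s IH].
  have : integrable_on a b (cst c) by exact: integrable_on_nondecreasing.
  by apply: eq_integrable => // x _; rewrite /= /jump_sum big_nil addr0.
have phiI : integrable_on a b (fun x => phi (x - t)).
  by apply: integrable_on_nondecreasing => x y xy; apply: phind; rewrite lerB.
have := integrableD (mI a b) (integrableZl (mI a b) (h t) phiI) IH.
by apply: eq_integrable => // x _; rewrite /= jump_sum_cons.
Qed.

Lemma integrable_on_norm_sub a b f g : integrable_on a b f -> integrable_on a b g ->
  integrable_on a b (fun x => `|f x - g x|).
Proof.
move=> fi gi; have := integrableB (mI a b) fi gi.
exact: integrable_norm.
Qed.

Lemma integrable_on_sub a b f g : integrable_on a b f -> integrable_on a b g ->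
  integrable_on a b (fun x => f x - g x).
Proof. by move=> fi gi; exact: (integrableB (mI a b) fi gi). Qed.

Lemma Rintegral_sub a b f g : integrable_on a b f -> integrable_on a b g ->
  \int[mu]_(x in `[a, b]) (f x - g x) =
  \int[mu]_(x in `[a, b]) f x - \int[mu]_(x in `[a, b]) g x.
Proof. exact: RintegralB. Qed.

Lemma finite_lebesgue0 E : measurable [set` E] /\ mu [set` E] = 0%E.
Proof.
have cE : countable [set` E] by apply/finite_set_countable/finite_seq.
by split; [exact: countable_measurable|exact: countable_lebesgue_measure0].
Qed.

(** On [E] the values of [g] are arbitrary, but every subset of a finite set is measurable. *)
Lemma eq_off_measurable (D : set R) E f g : measurable D -> measurable_fun D f ->
  (forall x, x \notin E -> g x = f x) -> measurable_fun D g.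
Proof.
move=> mD mf gf; have [mE _] := finite_lebesgue0 E.
rewrite -(setUIDK D [set` E]).
apply/measurable_funU; [exact: measurableI|exact: measurableD|split].
  move=> _ Y mY; apply: countable_measurable => //.
  apply: (@sub_countable _ _ _ [set` E]); last exact/finite_set_countable/finite_seq.
  by apply: subset_card_le => x [[]].
apply: (@eq_measurable_fun _ _ _ _ _ f).
  by move=> x; rewrite inE => -[_ /= /negP xE]; rewrite gf.
exact: measurable_funS mf.
Qed.

Lemma eq_off_integral (D : set R) E f g : measurable D -> measurable_fun D f ->
  (forall x, x \notin E -> g x = f x) ->
  (\int[mu]_(x in D) (g x)%:E = \int[mu]_(x in D) (f x)%:E)%E.
Proof.
move=> mD mf gf; have [mE E0] := finite_lebesgue0 E.
have mg := eq_off_measurable mD mf gf.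
apply: ae_eq_integral => //; try exact/measurable_EFinP.
exists [set` E]; split => // x /= xE; apply/negPn/negP => xnE.
by apply: xE => _; rewrite gf.
Qed.

End Integrals.

(** * The cumulative mass of a kernel *)

Section Kernel.
Variable R : realType.
Local Notation mu := (@lebesgue_measure R).

Lemma ge0_Rintegral_oppr (f : R -> R) : measurable_fun setT f ->
  (forall x, 0 <= f x) -> \int[mu]_x f x = \int[mu]_x f (- x).
Proof.
move=> mf f0; rewrite /Rintegral; congr fine.
rewrite (eq_measure_integral (pushforward mu (-%R : _ -> measurableTypeR R))).
  rewrite ge0_integral_pushforward//=.
    exact/measurable_EFinP.
  by move=> x _; rewrite lee_fin.
by move=> A mA _; exact/esym/lebesgue_measureN.
Qed.

Variables (K : R -> R) (kappa : R).
Hypothesis hK : convolution_kernel K.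
Hypothesis hsupp : supp K `<=` `[- kappa, kappa].

(** The mass of [K] to the left of [s], in the form of the convolution with [heaviside], so that
    convolving a step function is a matter of linearity. *)
Definition cumulative_mass (s : R) : R := \int[mu]_y (K y * heaviside (s - y)).

Local Notation theta := cumulative_mass.

Let mK : measurable_fun setT K.
Proof. by have := kernel_integrable hK => /measurable_int /measurable_EFinP. Qed.

Lemma measurable_heaviside s : measurable_fun setT (fun y : R => heaviside (s - y)).
Proof.
apply: nonincreasing_measurable => // x y xy.
rewrite !heaviside_sub ler_nat; case: ltP => // ys.
by rewrite (le_lt_trans xy ys).
Qed.

Lemma integrable_kernel_mul (w : R -> R) : measurable_fun setT w ->
  (forall y, `|w y| <= 1) -> mu.-integrable setT (EFin \o (fun y => K y * w y)).
Proof.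
move=> mw w1; apply: le_integrable (kernel_integrable hK) => //.
  exact/measurable_EFinP/measurable_funM.
by move=> x _; rewrite /= lee_fin normrM ler_piMr.
Qed.

Lemma integrable_kernel_heaviside s :
  mu.-integrable setT (EFin \o (fun y => K y * heaviside (s - y))).
Proof.
apply: integrable_kernel_mul; first exact: measurable_heaviside.
by move=> y; rewrite /heaviside; case: (0 < _)%R; rewrite ?normr1 ?normr0.
Qed.

Lemma cumulative_mass_nondecreasing : nondecreasing_fun theta.
Proof.
move=> s t st; apply: le_Rintegral => //; try exact: integrable_kernel_heaviside.
move=> y _; apply: ler_wpM2l; first exact: kernel_ge0.
rewrite !heaviside_sub ler_nat; case: ltP => // ys.
by rewrite (lt_le_trans ys st).
Qed.

(** By symmetry of [K], [theta (- s)] is the mass to the right of [s]; the two half-lines miss only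
    the null set of [s]. In particular [theta 0] is 1/2. *)
Lemma cumulative_mass_oppr s : theta s + theta (- s) = 1.
Proof.
have mh : measurable_fun setT (fun y : R => heaviside (y - s)).
  apply: nondecreasing_measurable => // x y xy.
  rewrite !heaviside_sub ler_nat; case: ltP => // sx.
  by rewrite (lt_le_trans sx xy).
have -> : theta (- s) = \int[mu]_y (K y * heaviside (y - s)).
  rewrite /theta ge0_Rintegral_oppr; last 2 first.
  - by apply: measurable_funM => //; exact: measurable_heaviside.
  - by move=> x; rewrite mulr_ge0 ?(kernel_ge0 hK).
  by apply: eq_Rintegral => x _; rewrite (kernel_symmetric hK) opprK addrC.
rewrite -RintegralD//; last 2 first.
- exact: integrable_kernel_heaviside.
- apply: integrable_kernel_mul => // y.
  by rewrite /heaviside; case: (0 < _)%R; rewrite ?normr1 ?normr0.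
rewrite -[RHS](kernel_mass hK) /Rintegral; congr fine.
apply: (@eq_off_integral _ _ [:: s]); [by []|exact: mK|].
move=> x; rewrite inE => xs; rewrite -mulrDr !heaviside_sub.
by case: ltgtP xs => // _ _; rewrite ?addr0 ?add0r mulr1.
Qed.

Lemma cumulative_mass_left s : s <= - kappa -> theta s = 0.
Proof.
move=> sk; rewrite /theta /Rintegral integral0_eq// => y _; congr _%:E.
rewrite heaviside_sub; case: ltP => [ys|_]; last by rewrite mulr0.
apply/eqP; rewrite mulr1; apply/negPn/negP => Ky0.
have /hsupp : supp K y by apply: subset_closure.
rewrite /= in_itv/=; lra.
Qed.

(** If [theta s] were equal to [theta 0], which is 1/2, then [K] would vanish almost everywhere
    between [s] and 0, against its positivity near the origin. *)
Lemma cumulative_mass_lt s : s < 0 -> theta s < 2^-1.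
Proof.
move=> s0; have := cumulative_mass_oppr 0; rewrite oppr0 => th0.
suff : theta s < theta 0 by lra.
have le := cumulative_mass_nondecreasing (ltW s0).
rewrite lt_neqAle le andbT; apply/eqP => eqth.
have [e /= e0 He] := kernel_pos hK.
pose w y := heaviside (0 - y) - heaviside (s - y).
have wE y : w y = (s <= y < 0)%R%:R.
  rewrite /w !heaviside_sub; case: (ltP y 0) => y0; case: (ltP y s) => ys//=; lra.
have wI : mu.-integrable setT (EFin \o (fun y => K y * w y)).
  apply: integrable_kernel_mul.
    apply: measurable_funB; exact: measurable_heaviside.
  by move=> y; rewrite wE; case: (_ && _); rewrite ?normr1 ?normr0.
have w0 : \int[mu]_y (K y * w y) = 0.
  under eq_Rintegral do rewrite mulrBr.
  rewrite RintegralB//; try exact: integrable_kernel_heaviside.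
  by rewrite -/(theta 0) -/(theta s) eqth subrr.
have /ae_eq_integral_abs : (\int[mu]_(y in setT) `|(K y * w y)%:E| = 0)%E.
  under eq_integral => y _.
    rewrite gee0_abs; last by rewrite lee_fin wE mulr_ge0 ?(kernel_ge0 hK).
    over.
  by rewrite -[LHS]fineK ?(integrable_fin_num _ wI)//; congr _%:E.
move=> /(_ measurableT (measurable_int mu wI)) [N [mN N0 NE]].
(* The interval from [m] to 0 lies both to the right of [s] and in the neighborhood where [K] is
   positive, and has positive measure. *)
pose m := Num.max s (- e / 2).
have m0 : m < 0 by rewrite /m gt_max; lra.
have : `]m, 0[ `<=` N.
  move=> y /=; rewrite in_itv/= => /andP[my y0]; apply: NE => /= /(_ I) [].
  have : m < y by []. rewrite /m gt_max => /andP[sy ey].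
  rewrite wE (ltW sy) y0 mulr1 => Ky.
  have : 0 < K y by apply: He => /=; rewrite sub0r normrN ltr0_norm; lra.
  by rewrite Ky ltxx.
have mI : measurable (`]m, 0[%classic : set (measurableTypeR R)) by exact: measurable_itv.
move=> sub; have : mu `]m, 0[%classic = 0%E.
  exact: (subset_measure0 (mu := mu) mI mN sub N0).
rewrite lebesgue_measure_itv/= lte_fin m0 -EFinB sub0r => -[]; lra.
Qed.

Lemma kernel_jump_sum_cons c (h : R -> R) t (s : seq R) x y :
  K y * jump_sum (@heaviside R) c h (t :: s) (x - y) =
  h t * (K y * heaviside (x - t - y)) +
  K y * jump_sum (@heaviside R) c h s (x - y).
Proof. by rewrite jump_sum_cons mulrDr mulrCA (addrAC x). Qed.

Lemma integrable_kernel_jump_sum c (h : R -> R) (s : seq R) x :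
  mu.-integrable setT (EFin \o (fun y => K y * jump_sum (@heaviside R) c h s (x - y))).
Proof.
elim: s => [|t s IH].
  have := integrableZl measurableT c (kernel_integrable hK).
  by apply: eq_integrable => // y _; rewrite /= /jump_sum big_nil addr0 mulrC.
have := integrableD measurableT
  (integrableZl measurableT (h t) (integrable_kernel_heaviside (x - t))) IH.
by apply: eq_integrable => // y _; rewrite /= kernel_jump_sum_cons.
Qed.

Lemma convolution_jump_sum c (h : R -> R) (s E : seq R) (g : R -> R) x :
  (forall y, y \notin E -> g y = jump_sum (@heaviside R) c h s y) ->
  convolution K g x = jump_sum theta c h s x.
Proof.
move=> gE.
transitivity (\int[mu]_y (K y * jump_sum (@heaviside R) c h s (x - y))).
  rewrite /convolution /Rintegral; congr fine.
  (* In the variable of integration the exceptional points are reflected about [x / 2]. *)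
  apply: (@eq_off_integral _ _ [seq x - y | y <- E]) => //.
    apply/measurable_EFinP; apply: (measurable_int mu); exact: integrable_kernel_jump_sum.
  move=> y yE; rewrite gE//; apply: contra yE => xyE.
  by apply/mapP; exists (x - y) => //; rewrite subKr.
elim: s {gE} => [|t s IH].
  rewrite (@eq_Rintegral _ _ _ mu _ (fun y => c * K y)); last first.
    by move=> y _; rewrite /jump_sum big_nil addr0 mulrC.
  by rewrite RintegralZl ?(kernel_mass hK) ?mulr1 ?/jump_sum ?big_nil ?addr0//;
    exact: kernel_integrable.
rewrite jump_sum_cons -IH.
rewrite (@eq_Rintegral _ _ _ mu _ (fun y => h t * (K y * heaviside (x - t - y)) +
  K y * jump_sum (@heaviside R) c h s (x - y))); last first.
  by move=> y _; rewrite kernel_jump_sum_cons.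
rewrite RintegralD//; last exact: integrable_kernel_jump_sum.
  rewrite RintegralZl//; exact: integrable_kernel_heaviside.
exact: (integrableZl measurableT _ (integrable_kernel_heaviside (x - t))).
Qed.

End Kernel.

(** * Comparison on a window around one jump *)

(** All window estimates bound the integrand below by a step function with three pieces; a piece may
    be empty. *)
Lemma Rintegral_ge_steps (R : realType) (a b c d m1 m2 m3 : R) (f : R -> R) :
  a <= b -> b <= c -> c <= d -> integrable_on a d f ->
  (forall x, a < x < b -> m1 <= f x) ->
  (forall x, b < x < c -> m2 <= f x) ->
  (forall x, c < x < d -> m3 <= f x) ->
  m1 * (b - a) + m2 * (c - b) + m3 * (d - c) <=
  \int[@lebesgue_measure R]_(x in `[a, d]) f x.
Proof.
move=> ab bc cd fi f1 f2 f3.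
rewrite (Rintegral_split (b := c)) ?(le_trans ab)// (Rintegral_split (b := b))//; last first.
  exact: integrable_onS fi.
by apply: lerD; [apply: lerD|]; apply: Rintegral_ge_cst => //; apply: integrable_onS fi => //; lra.
Qed.

Lemma sum3_eq0 (R : realDomainType) (x y z : R) : 0 <= x -> 0 <= y -> 0 <= z ->
  x + y + z <= 0 -> [/\ x = 0, y = 0 & z = 0].
Proof. by move=> *; split; lra. Qed.

Section Window.
Variable R : realType.
Local Notation mu := (@lebesgue_measure R).
Local Notation heaviside := (@heaviside R).
Implicit Types (x y t A B c j : R).

Variables (theta : R -> R) (kappa : R).
Hypothesis kappa_gt0 : 0 < kappa.
Hypothesis theta_nd : nondecreasing_fun theta.
Hypothesis theta_oppr : forall y, theta y + theta (- y) = 1.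
Hypothesis theta_left : forall y, y <= - kappa -> theta y = 0.
Hypothesis theta_lt : forall y, y < 0 -> theta y < 2^-1.

Lemma theta_right y : kappa <= y -> theta y = 1.
Proof. by move=> ky; have := theta_oppr y; rewrite [theta (- y)]theta_left; lra. Qed.

Lemma theta_le y : y <= 0 -> theta y <= 2^-1.
Proof.
rewrite le_eqVlt => /predU1P[->|/theta_lt/ltW//].
have := theta_oppr 0; rewrite oppr0; lra.
Qed.

Lemma theta_ge y : 0 <= y -> 2^-1 <= theta y.
Proof.
move=> y0; have := theta_oppr y; have := @theta_le (- y); rewrite oppr_le0 => /(_ y0); lra.
Qed.

Lemma theta_gt y : 0 < y -> 2^-1 < theta y.
Proof.
move=> y0; have := theta_oppr y; have := @theta_lt (- y); rewrite oppr_lt0 => /(_ y0); lra.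
Qed.

Lemma theta_ge0 y : 0 <= theta y.
Proof.
have [/theta_left->//|yk] := leP y (- kappa).
by rewrite -(theta_left (lexx (- kappa))); apply/theta_nd/ltW.
Qed.

Lemma theta_le1 y : theta y <= 1.
Proof. have := theta_oppr y; have := theta_ge0 (- y); lra. Qed.

Variable H : R.
Hypothesis H_neq0 : H != 0.

Lemma jump_errorE y : `|H * heaviside y - H * theta y| =
  `|H| * (if 0 < y then 1 - theta y else theta y).
Proof.
rewrite -mulrBr normrM /heaviside; congr (_ * _); case: ifPn => _ /=.
  by rewrite ger0_norm// subr_ge0 theta_le1.
by rewrite sub0r normrN ger0_norm// theta_ge0.
Qed.

Lemma jump_error_far y : y <= - kappa \/ kappa <= y ->
  `|H * heaviside y - H * theta y| = 0.
Proof.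
have k0 := kappa_gt0; rewrite jump_errorE => -[yk|ky].
  have y0 : y <= 0 by lra.
  by rewrite theta_left// ltNge y0 mulr0.
have y0 : 0 < y by lra.
by rewrite theta_right// y0 subrr mulr0.
Qed.

(** As [theta] crosses 1/2 at 0, [heaviside y] is whichever of 0 and 1 is nearest to [theta y]. This
    also explains the next two bounds, by the error of the left and of the right level. *)
Lemma jump_error_le y : `|H * heaviside y - H * theta y| <= `|H| / 2.
Proof.
rewrite jump_errorE; apply: ler_wpM2l => //.
by case: ltP => [/ltW/theta_ge|/theta_le]; lra.
Qed.

Lemma jump_error_le_left y : `|H * heaviside y - H * theta y| <= `|H * theta y|.
Proof.
rewrite jump_errorE normrM (ger0_norm (theta_ge0 y)); apply: ler_wpM2l => //.
by case: ltP => // /ltW/theta_ge; lra.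
Qed.

Lemma jump_error_le_right y : `|H * heaviside y - H * theta y| <= `|H - H * theta y|.
Proof.
rewrite jump_errorE -{2}(mulr1 H) -mulrBr normrM.
have -> : `|1 - theta y| = 1 - theta y by rewrite ger0_norm// subr_ge0 theta_le1.
by apply: ler_wpM2l => //; case: ltP => // /theta_le; lra.
Qed.

(** [F] and [G] are f and g near a jump [j] of signed height [H], and [r] is half the length of the
    window. [excess] is the pointwise loss of the competitor [u] against g. *)
Variables (u F G : R -> R) (c j r : R).
Hypothesis r_gt : 3 * kappa < r.
Hypothesis FE : forall x, j - r < x < j + r -> F x = c + H * theta (x - j).
Hypothesis GE : forall x, j - r < x < j + r -> G x = c + H * heaviside (x - j).
Let excess x := `|u x - F x| - `|G x - F x|.
Hypothesis excess_int : integrable_on (j - r) (j + r) excess.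

Lemma excessE x : j - r < x < j + r -> excess x =
  `|u x - (c + H * theta (x - j))| - `|H * heaviside (x - j) - H * theta (x - j)|.
Proof. by move=> xW; rewrite /excess FE// GE//; congr (_ - `|_|); lra. Qed.

(** The error of g lives on a length [2 * kappa] and is at most half of [|H|], so no competitor can
    save more than this. *)
Lemma window_excess_ge :
  - (kappa * `|H|) <= \int[mu]_(x in `[j - r, j + r]) excess x.
Proof.
have [k0 rk] := (kappa_gt0, r_gt).
have -> : - (kappa * `|H|) = 0 * ((j - kappa) - (j - r)) +
   (- (`|H| / 2)) * ((j + kappa) - (j - kappa)) + 0 * ((j + r) - (j + kappa)) by lra.
apply: Rintegral_ge_steps => //; try lra; move=> x xP.
all: rewrite excessE; last lra.
- by rewrite jump_error_far ?subr0//; left; lra.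
- have := jump_error_le (x - j); have := normr_ge0 (u x - (c + H * theta (x - j))); lra.
- by rewrite jump_error_far ?subr0//; right; lra.
Qed.

(** A constant errs by [|A|] on the left and [|A - H|] on the right, each on a length [r - kappa];
    by the triangle inequality this is at least [(r - kappa) * |H|]. The middle part saves at most
    [kappa * |H|]. *)
Lemma window_excess_cst A : (forall x, j - r < x < j + r -> u x = c + A) ->
  (r - 2 * kappa) * `|H| <= \int[mu]_(x in `[j - r, j + r]) excess x.
Proof.
have [k0 rk] := (kappa_gt0, r_gt).
move=> uE.
apply: (@le_trans _ _ (`|A| * ((j - kappa) - (j - r)) +
   (- (`|H| / 2)) * ((j + kappa) - (j - kappa)) + `|A - H| * ((j + r) - (j + kappa)))).
  have := ler_normB A (A - H); rewrite opprB addrCA subrr addr0 => tri.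
  have : 0 <= (r - kappa) * (`|A| + `|A - H| - `|H|) by apply: mulr_ge0; lra.
  by lra.
apply: Rintegral_ge_steps => //; try lra; move=> x xP.
all: rewrite excessE; last lra.
- rewrite jump_error_far ?subr0; last by left; lra.
  by rewrite uE ?theta_left; [|lra|lra];
    rewrite le_eqVlt; apply/orP; left; apply/eqP; congr `|_|; lra.
- have := jump_error_le (x - j); have := normr_ge0 (u x - (c + H * theta (x - j))); lra.
- rewrite jump_error_far ?subr0; last by right; lra.
  by rewrite uE ?theta_right; [|lra|lra];
    rewrite le_eqVlt; apply/orP; left; apply/eqP; congr `|_|; lra.
Qed.

(** * Competitors with a single jump in the window *)

Section OneJump.
Variables (A B t : R).
Hypothesis uE : forall x, j - r < x < j + r -> u x = c + A + (B - A) * heaviside (x - t).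

Lemma excess_before x : j - r < x < j + r -> x < t ->
  excess x = `|A - H * theta (x - j)| - `|H * heaviside (x - j) - H * theta (x - j)|.
Proof.
have [k0 rk] := (kappa_gt0, r_gt).
move=> xW xt; rewrite excessE// uE// heaviside_sub (lt_gtF xt) mulr0.
by congr (`|_| - _); lra.
Qed.

Lemma excess_after x : j - r < x < j + r -> t < x ->
  excess x = `|B - H * theta (x - j)| - `|H * heaviside (x - j) - H * theta (x - j)|.
Proof.
have [k0 rk] := (kappa_gt0, r_gt).
move=> xW xt; rewrite excessE// uE// heaviside_sub xt mulr1.
by congr (`|_| - _); lra.
Qed.

Lemma excess_far x : j - r < x < j + r -> x <= j - kappa \/ j + kappa <= x ->
  0 <= excess x.
Proof.
have [k0 rk] := (kappa_gt0, r_gt).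
move=> xW xk; rewrite excessE//.
by rewrite jump_error_far ?subr0//; lra.
Qed.

(** The level 0 is nowhere better than g, and moving it to [A] changes the error by at most
    [|A|]. *)
Lemma excess_before_ge x : j - r < x < j + r -> x < t -> - `|A| <= excess x.
Proof.
have [k0 rk] := (kappa_gt0, r_gt).
move=> xW xt; rewrite excess_before//.
have := jump_error_le_left (x - j); have := ler_distD A 0 (H * theta (x - j)).
rewrite !sub0r !normrN; lra.
Qed.

Lemma excess_after_ge x : j - r < x < j + r -> t < x -> - `|B - H| <= excess x.
Proof.
have [k0 rk] := (kappa_gt0, r_gt).
move=> xW xt; rewrite excess_after//.
have := jump_error_le_right (x - j); have := ler_distD B H (H * theta (x - j)).
rewrite (distrC H B); lra.
Qed.

(* The excess is at least [rho], [- rho], [delta - `|B - H|], [- `|B - H|],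
   [`|B - H|] on the successive intervals with endpoints
   [j - r, j - kappa, m, n, j + kappa, j + r]. Since [3 * kappa < r] the
   intervals carrying [rho] and [`|B - H|] outweigh those carrying [- rho] and
   [- `|B - H|]; [delta] is the price of displacing the jump from [j] to [t]. *)
Lemma window_excess_one_left : t <= j ->
  let I := \int[mu]_(x in `[j - r, j + r]) excess x in
  0 <= I /\ (I = 0 -> [/\ t = j, A = 0 & B = H]).
Proof.
have [k0 rk] := (kappa_gt0, r_gt).
move=> tj I.
(* The jump is clipped to the zone where f differs from g. If [t] lies before that zone, the level
   [A] need not be seen on the left part, so [rho] is then 0. *)
pose m := Num.max t (j - kappa).
pose rho := if j - kappa < t then `|A| else 0.
have rho0 : 0 <= rho by rewrite /rho; case: ifP.
have mP : [/\ t <= m, j - kappa <= m & m <= j].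
  by rewrite /m !le_max ge_max !lexx orbT; split => //; lra.
have mt : j - kappa < m -> j - kappa < t /\ m = t.
  by rewrite /m; case: (ltP t (j - kappa)) => //; lra.
case: mP => tm km mj.
(* Stopping halfway to [j] keeps [theta] below [theta (n - j) < 1 / 2], which gives a uniform gain
   [delta]. *)
pose n := (m + j) / 2.
pose delta := `|H| * (1 - 2 * theta (n - j)).
have delta0 : m < j -> 0 < delta.
  move=> mj'; rewrite mulr_gt0 ?normr_gt0//.
  by have := @theta_lt (n - j); rewrite /n => /(_ ltac:(lra)); lra.
have delta0' : 0 <= delta * (n - m).
  have [|jm] := ltP m j; last by rewrite /n (_ : _ - m = 0) ?mulr0//; lra.
  by move=> mj'; rewrite mulr_ge0 ?ltW ?delta0// /n; lra.
have I1 : rho * ((j - kappa) - (j - r)) + (- rho) * (m - (j - kappa)) +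
    (delta - `|B - H|) * (n - m) <= \int[mu]_(x in `[j - r, n]) excess x.
  apply: Rintegral_ge_steps; rewrite /n; try lra.
    by apply: integrable_onS excess_int; rewrite /n; lra.
  - move=> x xP; rewrite /rho; case: ifP => kt; last by apply: excess_far; [lra|left; lra].
    rewrite excess_before ?jump_error_far ?subr0; [|left; lra|lra|lra].
    by rewrite theta_left ?mulr0 ?subr0//; lra.
  - move=> x xP; have [|kt mE] := mt; first lra.
    by rewrite /rho kt; apply: excess_before_ge; lra.
  - move=> x xP; rewrite excess_after ?jump_errorE; [|lra|lra].
    have xj : x <= j by lra.
    rewrite subr_gt0 ltNge xj /=.
    have := ler_distD B H (H * theta (x - j)); rewrite (distrC H B).
    have -> : `|H - H * theta (x - j)| = `|H| * (1 - theta (x - j)).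
      rewrite -{1}(mulr1 H) -mulrBr normrM; congr (_ * _).
      by rewrite ger0_norm// subr_ge0 theta_le1.
    have : `|H| * theta (x - j) <= `|H| * theta (n - j).
      by apply: ler_wpM2l => //; apply: theta_nd; rewrite /n; lra.
    rewrite /delta /n; lra.
have I2 : 0 * (n - n) + (- `|B - H|) * ((j + kappa) - n) +
    `|B - H| * ((j + r) - (j + kappa)) <= \int[mu]_(x in `[n, j + r]) excess x.
  apply: Rintegral_ge_steps; rewrite /n; try lra.
    by apply: integrable_onS excess_int; rewrite /n; lra.
  - by move=> x xP; lra.
  - by move=> x xP; apply: excess_after_ge; lra.
  - move=> x xP; rewrite excess_after ?jump_error_far ?subr0; [|right; lra|lra|lra].
    by rewrite theta_right ?mulr1//; lra.
have IE : I = \int[mu]_(x in `[j - r, n]) excess x + \int[mu]_(x in `[n, j + r]) excess x.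
  by apply: Rintegral_split => //; rewrite /n; lra.
(* The factors of [rho] and [|B - H|] are positive, since [m] lies between [j - kappa] and [j] and
   [3 * kappa < r]. Hence equality will force both to vanish. *)
have P1 : 0 <= rho * (j + r - 2 * kappa - m) by apply: (mulr_ge0 rho0); lra.
have P2 : 0 <= `|B - H| * (r - 2 * kappa - j + m) by apply: (mulr_ge0 (normr_ge0 _)); lra.
have II : rho * (j + r - 2 * kappa - m) + `|B - H| * (r - 2 * kappa - j + m) +
   delta * (n - m) <= I.
  rewrite IE; move: (lerD I1 I2); apply: le_trans; rewrite /n.
  by rewrite le_eqVlt; apply/orP; left; apply/eqP; ring.
split; first by lra.
move=> I0; rewrite I0 in II.
have [/eqP R0 /eqP B0 D0] := sum3_eq0 P1 P2 delta0' II; move: B0.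
rewrite mulf_eq0 normr_eq0 subr_eq0 => /orP[/eqP BH|/eqP]; last lra.
have mjE : m = j.
  apply/le_anti; rewrite mj/= leNgt; apply/negP => mj'.
  have : 0 < delta * (n - m) by rewrite mulr_gt0 ?delta0// /n; lra.
  by rewrite D0 ltxx.
(* Since [m = j] is beyond [j - kappa], no clipping took place: [m = t] and [rho] is [|A|]. *)
have [|kt mE] := mt; first lra.
move: R0; rewrite mulf_eq0 /rho kt normr_eq0 => /orP[/eqP A0|/eqP]; last lra.
by split=> //; lra.
Qed.

(** Mirror image of the previous lemma with [A] and [B - H] exchanged: the bounds are [|A|],
    [- |A|], [delta - |A|], [- rho], [rho] between the successive points [j - r], [j - kappa], [n],
    [m], [j + kappa], [j + r]. *)
Lemma window_excess_one_right : j <= t ->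
  let I := \int[mu]_(x in `[j - r, j + r]) excess x in
  0 <= I /\ (I = 0 -> [/\ t = j, A = 0 & B = H]).
Proof.
have [k0 rk] := (kappa_gt0, r_gt).
move=> tj I.
pose m := Num.min t (j + kappa).
pose rho := if t < j + kappa then `|B - H| else 0.
have rho0 : 0 <= rho by rewrite /rho; case: ifP.
have mP : [/\ m <= t, m <= j + kappa & j <= m].
  by rewrite /m !ge_min le_min !lexx orbT; split => //; lra.
have mt : m < j + kappa -> t < j + kappa /\ m = t.
  by rewrite /m; case: (ltP t (j + kappa)) => //; lra.
case: mP => tm km mj.
pose n := (m + j) / 2.
pose delta := `|H| * (2 * theta (n - j) - 1).
have delta0 : j < m -> 0 < delta.
  move=> mj'; rewrite mulr_gt0 ?normr_gt0//.
  by have := @theta_gt (n - j); rewrite /n => /(_ ltac:(lra)); lra.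
have delta0' : 0 <= delta * (m - n).
  have [|jm] := ltP j m; last by rewrite /n (_ : m - _ = 0) ?mulr0//; lra.
  by move=> mj'; rewrite mulr_ge0 ?ltW ?delta0// /n; lra.
have I1 : `|A| * ((j - kappa) - (j - r)) + (- `|A|) * (n - (j - kappa)) +
    0 * (n - n) <= \int[mu]_(x in `[j - r, n]) excess x.
  apply: Rintegral_ge_steps; rewrite /n; try lra.
    by apply: integrable_onS excess_int; rewrite /n; lra.
  - move=> x xP; rewrite excess_before ?jump_error_far ?subr0; [|left; lra|lra|lra].
    by rewrite theta_left ?mulr0 ?subr0//; lra.
  - by move=> x xP; apply: excess_before_ge; lra.
  - by move=> x xP; lra.
have I2 : (delta - `|A|) * (m - n) + (- rho) * ((j + kappa) - m) +
    rho * ((j + r) - (j + kappa)) <= \int[mu]_(x in `[n, j + r]) excess x.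
  apply: Rintegral_ge_steps; rewrite /n; try lra.
    by apply: integrable_onS excess_int; rewrite /n; lra.
  - move=> x xP; rewrite excess_before ?jump_errorE; [|lra|lra].
    have jx : j < x by lra.
    rewrite subr_gt0 jx.
    have := ler_distD A 0 (H * theta (x - j)); rewrite !sub0r !normrN.
    rewrite normrM (ger0_norm (theta_ge0 _)).
    have : `|H| * theta (n - j) <= `|H| * theta (x - j).
      by apply: ler_wpM2l => //; apply: theta_nd; rewrite /n; lra.
    rewrite /delta /n; lra.
  - move=> x xP; have [|kt mE] := mt; first lra.
    by rewrite /rho kt; apply: excess_after_ge; lra.
  - move=> x xP; rewrite /rho; case: ifP => kt; last by apply: excess_far; [lra|right; lra].
    rewrite excess_after ?jump_error_far ?subr0; [|right; lra|lra|lra].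
    by rewrite theta_right ?mulr1//; lra.
have IE : I = \int[mu]_(x in `[j - r, n]) excess x + \int[mu]_(x in `[n, j + r]) excess x.
  by apply: Rintegral_split => //; rewrite /n; lra.
have P1 : 0 <= rho * (r - 2 * kappa - j + m) by apply: (mulr_ge0 rho0); lra.
have P2 : 0 <= `|A| * (j + r - 2 * kappa - m) by apply: (mulr_ge0 (normr_ge0 _)); lra.
have II : rho * (r - 2 * kappa - j + m) + `|A| * (j + r - 2 * kappa - m) +
   delta * (m - n) <= I.
  rewrite IE; move: (lerD I1 I2); apply: le_trans; rewrite /n.
  by rewrite le_eqVlt; apply/orP; left; apply/eqP; ring.
split; first by lra.
move=> I0; rewrite I0 in II.
have [/eqP R0 /eqP A0 D0] := sum3_eq0 P1 P2 delta0' II; move: A0.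
rewrite mulf_eq0 normr_eq0 => /orP[/eqP A0|/eqP]; last lra.
have mjE : m = j.
  apply/le_anti; rewrite mj/= andbT leNgt; apply/negP => mj'.
  have : 0 < delta * (m - n) by rewrite mulr_gt0 ?delta0// /n; lra.
  by rewrite D0 ltxx.
have [|kt mE] := mt; first lra.
move: R0; rewrite mulf_eq0 /rho kt normr_eq0 subr_eq0 => /orP[/eqP BH|/eqP]; last lra.
by split=> //; lra.
Qed.

Lemma window_excess_one :
  let I := \int[mu]_(x in `[j - r, j + r]) excess x in
  0 <= I /\ (I = 0 -> [/\ t = j, A = 0 & B = H]).
Proof.
by have [tj|/ltW jt] := leP t j;
  [exact: window_excess_one_left|exact: window_excess_one_right].
Qed.

End OneJump.
End Window.

(** * Summation over the windows *)

Lemma leq_count_add (T : Type) (p q w : pred T) (l : seq T) :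
  (forall t, p t + q t <= w t)%N -> (count p l + count q l <= count w l)%N.
Proof. by move=> pqw; elim: l => //= t l IH; rewrite addnACA leq_add. Qed.

Section LocalForm.
Variable R : realType.
Implicit Types (c x t j : R) (h phi : R -> R) (s : seq R).

(** Jumps up to [a] are already passed and go into the constant; those from [b] on have not
    begun. *)
Lemma jump_sum_itv c h s a b : exists c', forall x, a < x < b ->
  jump_sum (@heaviside R) c h s x =
  jump_sum (@heaviside R) c' h [seq t <- s | a < t < b] x.
Proof.
exists (c + \sum_(t <- s | t <= a) h t) => x /andP[ax xb].
rewrite /jump_sum -addrA; congr (_ + _).
rewrite big_filter [X in X + _]big_mkcond [X in _ + X]big_mkcond -big_split /=.
apply: eq_bigr => t _; rewrite heaviside_sub.
have [ta|at_] := leP t a; first by rewrite (le_lt_trans ta ax) mulr1 addr0.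
have [tb|bt] := ltP t b; first by rewrite add0r.
by rewrite (lt_gtF (lt_le_trans xb bt)) mulr0 addr0.
Qed.

(** The other jumps are at least [r] away from the window, where the profile is saturated. The
    constant is chosen before [phi] so that f and g share it. *)
Lemma jump_sum_near c h s j r kappa : uniq s -> j \in s -> kappa <= r ->
  {in s, forall t, t != j -> 2 * r <= `|t - j|} ->
  exists c', forall phi, (forall y, y <= - kappa -> phi y = 0) ->
    (forall y, kappa <= y -> phi y = 1) ->
    forall x, j - r < x < j + r -> jump_sum phi c h s x = c' + h j * phi (x - j).
Proof.
move=> us js kr sep.
exists (c + \sum_(t <- s | t != j) h t * (t < j)%R%:R) => phi phi0 phi1 x xW.
rewrite /jump_sum (bigD1_seq j)//= addrA addrAC; congr (_ + _ + _).
rewrite [LHS]big_seq_cond [RHS]big_seq_cond.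
apply: eq_bigr => t /andP[ts tj]; have H := sep t ts tj; congr (_ * _).
have [tlt|jt|tE] := ltgtP t j; last by rewrite tE eqxx in tj.
  by move: H; rewrite ltr0_norm ?subr_lt0// => H; rewrite phi1//; lra.
by move: H; rewrite gtr0_norm ?subr_gt0// => H; rewrite phi0//; lra.
Qed.

Lemma jump_sum_far c h s kappa phi : 0 < kappa -> (forall y, y <= - kappa -> phi y = 0) ->
  (forall y, kappa <= y -> phi y = 1) -> forall x,
  {in s, forall t, kappa <= `|x - t|} ->
  jump_sum phi c h s x = jump_sum (@heaviside R) c h s x.
Proof.
move=> k0 phi0 phi1 x far; rewrite /jump_sum; congr (_ + _).
apply: eq_big_seq => t /far; rewrite /heaviside.
have [xt|xt|->] := ltgtP x t; last by rewrite subrr normr0; lra.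
  rewrite ltr0_norm ?subr_lt0// => H.
  by rewrite phi0 ?subr_gt0 ?(lt_gtF xt)//; lra.
by rewrite gtr0_norm ?subr_gt0// => H; rewrite phi1// xt.
Qed.

End LocalForm.

(** * Comparison over the whole interval *)

Section Comparison.
Variable R : realType.
Local Notation mu := (@lebesgue_measure R).
Variables (theta : R -> R) (kappa : R).
Hypothesis kappa_gt0 : 0 < kappa.
Hypothesis theta_nd : nondecreasing_fun theta.
Hypothesis theta_oppr : forall y, theta y + theta (- y) = 1.
Hypothesis theta_left : forall y, y <= - kappa -> theta y = 0.
Hypothesis theta_lt : forall y, y < 0 -> theta y < 2^-1.

Variables (c : R) (h : R -> R) (s : seq R) (cu : R) (hu : R -> R) (su : seq R).
Let G := jump_sum (@heaviside R) c h s.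
Let F := jump_sum theta c h s.
Let u := jump_sum (@heaviside R) cu hu su.
Let excess x := `|u x - F x| - `|G x - F x|.

Lemma heaviside_nondecreasing : nondecreasing_fun (@heaviside R).
Proof.
move=> x y xy; rewrite /heaviside ler_nat; case: (ltP 0 x) => // x0.
by rewrite (lt_le_trans x0 xy).
Qed.

Lemma integrable_on_excess a b : integrable_on a b excess.
Proof.
have nd := heaviside_nondecreasing.
by apply: integrable_on_sub; apply: integrable_on_norm_sub; exact: integrable_on_jump_sum.
Qed.

Lemma integrable_on_dist a b : integrable_on a b (fun x => `|u x - G x|).
Proof.
have nd := heaviside_nondecreasing.
by apply: integrable_on_norm_sub; exact: integrable_on_jump_sum.
Qed.

Variables (gamma r : R).
Hypothesis r_gt : 3 * kappa < r.
Hypothesis gamma_gt0 : 0 < gamma.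
Hypothesis us : uniq s.
Hypothesis h_neq0 : {in s, forall t, h t != 0}.
Hypothesis sep : {in s &, forall t j, t != j -> 2 * r <= `|t - j|}.
Hypothesis gamma_lo : {in s, forall t, kappa * `|h t| < gamma}.
Hypothesis gamma_hi : {in s, forall t, gamma < (r - 2 * kappa) * `|h t|}.

(** The cases are the numbers of jumps of [u] in the window. With none, [gamma_hi] gives a strict
    inequality; with two or more, [gamma_lo] does. Equality is thus possible only with one jump,
    which then agrees with that of g. *)
Lemma window_cost j : j \in s ->
  let I := \int[mu]_(x in `[j - r, j + r]) excess x in
  let k := (count (fun t => (j - r < t < j + r)%R) su)%:R : R in
  gamma <= gamma * k + I /\
  (gamma = gamma * k + I -> \int[mu]_(x in `[j - r, j + r]) `|u x - G x| = 0).
Proof.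
move=> js I k; have [k0 rk] := (kappa_gt0, r_gt).
have [||c' loc] := @jump_sum_near R c h s j r kappa us js; first by lra.
  by move=> t ts tj; exact: sep.
have FE := loc theta theta_left (theta_right theta_oppr theta_left).
have GE := loc (@heaviside R).
have {}GE : forall x, j - r < x < j + r -> G x = c' + h j * heaviside (x - j).
  apply: GE => y yk; rewrite /heaviside; last by have -> : 0 < y by lra.
  by have -> : (0 < y) = false by apply/negbTE; rewrite -leNgt; lra.
have [c'' uE] : exists c'', forall x, j - r < x < j + r ->
    u x = jump_sum (@heaviside R) c'' hu [seq t <- su | j - r < t < j + r] x.
  exact: jump_sum_itv.
have exI := @integrable_on_excess (j - r) (j + r).
have hj := h_neq0 js; have lo := gamma_lo js; have hi := gamma_hi js.
have low := window_excess_ge kappa_gt0 theta_nd theta_oppr theta_left theta_lt r_gt FE GE exI.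
rewrite -/I in low.
have kE : k = (size [seq t <- su | j - r < t < j + r])%:R by rewrite size_filter.
have g0 : 0 <= gamma.
  by apply: le_trans (ltW lo); rewrite mulr_ge0// ltW.
move: kE uE; case: [seq t <- su | j - r < t < j + r] => [|t [|t' s']] kE uE.
- have := window_excess_cst kappa_gt0 theta_nd theta_oppr theta_left theta_lt r_gt FE GE exI
    (A := c'' - c').
  rewrite -/I => /(_ _)/wrap[].
    by move=> x /uE ->; rewrite /jump_sum big_nil; lra.
  by move=> hI; rewrite kE mulr0 add0r; split; lra.
- have := window_excess_one kappa_gt0 theta_nd theta_oppr theta_left theta_lt hj r_gt FE GE exI
    (A := c'' - c') (B := c'' - c' + hu t) (t := t).
  rewrite -/I => /(_ _)/wrap[].
    by move=> x /uE ->; rewrite /jump_sum big_seq1; lra.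
  move=> [I0 Ieq]; rewrite kE mulr1; split; first lra.
  move=> gE; have [|tj A0 B0] := Ieq; first lra.
  apply: Rintegral_itv_eq0; first exact: integrable_on_dist.
  move=> x xW; rewrite uE// GE// /jump_sum big_seq1.
  have [-> ->] : c'' = c' /\ hu t = h j by split; lra.
  by rewrite tj subrr normr0.
- have : gamma * 2 <= gamma * k.
    by apply: ler_wpM2l => //; rewrite kE ler_nat.
  by split; lra.
Qed.

Lemma comparison_gap a b : a <= b ->
  (forall x, a <= x <= b -> G x = F x) ->
  \int[mu]_(x in `[a, b]) excess x = \int[mu]_(x in `[a, b]) `|u x - G x|.
Proof.
move=> ab GF; apply: eq_Rintegral => x; rewrite inE/= in_itv/= => xab.
by rewrite /excess -GF// subrr normr0 subr0.
Qed.

Lemma dist_ge0 a b : 0 <= \int[mu]_(x in `[a, b]) `|u x - G x|.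
Proof. by apply: Rintegral_ge0. Qed.

(** Jumps in a gap or at an end of a window are counted on the right only; they merely add to the
    cost of the competitor. *)
Lemma leq_count_windows a b d (l : seq R) : a <= b -> b <= d -> d <= 1 ->
  (count (fun t => (b < t < d)%R) l + count (fun t => (d < t < 1)%R) l <=
   count (fun t => (a < t < 1)%R) l)%N.
Proof.
move=> ab bd d1; apply: leq_count_add => t; have [td|dt] := ltP t d.
  rewrite (lt_gtF td) (lt_le_trans td d1) !andbT addn0.
  by case: (ltP b t) => // bt; rewrite (le_lt_trans ab bt).
rewrite andbF add0n; have [dt'|//] := ltP d t.
by rewrite (le_lt_trans (le_trans ab bd) dt').
Qed.

(** Equality in a sum of inequalities forces equality in each, which carries the equality case over
    to every piece. *)
Lemma add_costs (p n k k1 k2 d x y : R) : 0 <= d -> p <= k1 + x -> n <= k2 + y ->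
  k1 + k2 <= k ->
  n + p <= k + (d + x + y) /\
  (n + p = k + (d + x + y) -> [/\ d = 0, p = k1 + x & n = k2 + y]).
Proof. by move=> d0 pk nk kk; split; [|move=> E; split]; lra. Qed.

(** Induction on the jumps of g to the right of [a], splitting off a gap up to [j - r] and the
    window of [j]. The path starts at [a - r] so that the first window begins after [a]; for the new
    left end [j + r] it starts at [j]. *)
Lemma comparison a js : {subset js <= s} ->
  path (fun x y => x + 2 * r <= y) (a - r) (rcons js 1) ->
  (forall x, a <= x <= 1 -> {in js, forall t, r <= `|x - t|} -> G x = F x) ->
  let I := \int[mu]_(x in `[a, 1]) excess x in
  let k := (count (fun t => (a < t < 1)%R) su)%:R : R in
  gamma * (size js)%:R <= gamma * k + I /\
  (gamma * (size js)%:R = gamma * k + I -> \int[mu]_(x in `[a, 1]) `|u x - G x| = 0).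
Proof.
have rk : 0 < r by apply: lt_trans r_gt; rewrite mulr_gt0.
have k0 := kappa_gt0; have g0 := gamma_gt0.
elim: js a => [|j js IH] a jss /= ap GF.
  rewrite andbT in ap; have a1 : a <= 1 by lra.
  rewrite comparison_gap//; last by move=> x xa; apply: GF.
  have d0 := dist_ge0 a 1; rewrite mulr0.
  set k := _%:R; have : 0 <= gamma * k by exact: (mulr_ge0 (ltW g0) (ler0n _ _)).
  by split; lra.
case/andP: ap => aj jp.
have jsj : j \in s by apply: jss; rewrite inE eqxx.
have jsub : {subset js <= s} by move=> t tjs; apply: jss; rewrite inE tjs orbT.
have [far j1] : {in js, forall t, j + 2 * r <= t} /\ j + 2 * r <= 1.
  have tr : transitive (fun x y : R => x + 2 * r <= y) by move=> y x z xy yz; lra.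
  have /allP H := order_path_min tr jp.
  by split=> [t tjs|]; apply: H; rewrite mem_rcons inE ?eqxx ?tjs ?orbT.
have [ajr jrr jr1 ajr'] : [/\ a <= j - r, j - r <= j + r, j + r <= 1 & a <= j + r].
  by split; lra.
have [W1 W2] := window_cost jsj.
have [||I1 I2] := IH (j + r) jsub.
- by rewrite addrK.
- move=> x xj H; apply: GF; first lra.
  move=> t; rewrite inE => /predU1P[->|]; last exact: H.
  by rewrite ger0_norm; lra.
have E0 : \int[mu]_(x in `[a, j - r]) excess x = \int[mu]_(x in `[a, j - r]) `|u x - G x|.
  apply: comparison_gap => //.
  move=> x xa; apply: GF; first lra.
  move=> t; rewrite inE => tjs; have jt : j <= t.
    by case/predU1P: tjs => [->//|/far]; lra.
  by rewrite ler0_norm; lra.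
have IE : \int[mu]_(x in `[a, 1]) excess x = \int[mu]_(x in `[a, j - r]) `|u x - G x| +
   \int[mu]_(x in `[j - r, j + r]) excess x + \int[mu]_(x in `[j + r, 1]) excess x.
  have ei := integrable_on_excess.
  rewrite (@Rintegral_split _ a (j + r) 1)//.
  by rewrite (@Rintegral_split _ a (j - r) (j + r))// E0.
have UE : \int[mu]_(x in `[a, 1]) `|u x - G x| = \int[mu]_(x in `[a, j - r]) `|u x - G x| +
   \int[mu]_(x in `[j - r, j + r]) `|u x - G x| + \int[mu]_(x in `[j + r, 1]) `|u x - G x|.
  have ei := integrable_on_dist.
  rewrite (@Rintegral_split _ a (j + r) 1)//.
  by rewrite (@Rintegral_split _ a (j - r) (j + r))//.
have kE : gamma * (count (fun t => (j - r < t < j + r)%R) su)%:R +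
   gamma * (count (fun t => (j + r < t < 1)%R) su)%:R
   <= gamma * (count (fun t => (a < t < 1)%R) su)%:R.
  rewrite -mulrDr -natrD; apply: ler_wpM2l; first exact: ltW.
  by rewrite ler_nat; apply: leq_count_windows; rewrite // ltW.
rewrite IE UE -natr1 mulrDr mulr1.
have [le eq] := add_costs (dist_ge0 a (j - r)) W1 I1 kE.
by split=> // /eq[-> /W2-> /I2->]; rewrite !addr0.
Qed.

End Comparison.

(** * The Potts functional *)

Section Extrema.
Variable R : realType.
Implicit Types (a l x : R) (s : seq R).

Lemma seq_min_le s x : x \in s -> seq_min s <= x.
Proof.
rewrite /seq_min; move: (head 0 s) => d; elim: s => // y s IH.
by rewrite inE big_cons ge_min => /predU1P[->|/IH->]; rewrite ?lexx ?orbT.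
Qed.

Lemma seq_max_ge s x : x \in s -> x <= seq_max s.
Proof.
rewrite /seq_max; move: (head 0 s) => d; elim: s => // y s IH.
by rewrite inE big_cons le_max => /predU1P[->|/IH->]; rewrite ?lexx ?orbT.
Qed.

Lemma seq_min_gt0 s : (0 < size s)%N -> {in s, forall x, 0 < x} -> 0 < seq_min s.
Proof.
case: s => // y s _ s0; rewrite /seq_min big_seq /=.
apply: (big_ind (fun z => 0 < z)) => //; first by apply: s0; rewrite mem_head.
by move=> x z x0 z0; rewrite lt_min x0.
Qed.

Lemma path_lengths l a s : {in pairmap (fun x y => y - x) a s, forall d, l <= d} ->
  path (fun x y => x + l <= y) a s.
Proof.
elim: s a => //= y s IH a H; apply/andP; split.
  by have := H (y - a); rewrite mem_head => /(_ isT); lra.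
by apply: IH => d ds; apply: H; rewrite inE ds orbT.
Qed.

Lemma path_separated l a s : 0 <= l -> path (fun x y => x + l <= y) a s ->
  {in s &, forall x y, x != y -> l <= `|x - y|}.
Proof.
move=> l0; elim: s a => //= z s IH a /andP[_ zs].
have far : {in s, forall y, z + l <= y}.
  have tr : transitive (fun x y : R => x + l <= y) by move=> y x w xy yw; lra.
  by move=> y ys; have /allP := order_path_min tr zs; exact.
move=> x y; rewrite !inE => /predU1P[->|xs] /predU1P[->|ys].
- by rewrite eqxx.
- by move=> _; have zy := far y ys; rewrite distrC ger0_norm; lra.
- by move=> _; have zx := far x xs; rewrite ger0_norm; lra.
- exact: IH zs x y xs ys.
Qed.

End Extrema.

(** Turns the bounds on [kappa] and [gamma] into the strict inequalities used on the windows, whose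
    half-length is half of [l_min g]. *)
Lemma potts_parameters (R : realType) (g : R -> R) (kappa gamma : R) :
  0 < kappa -> (0 < nb_jumps g)%N ->
  {in jumps g, forall t, rval g t - lval g t != 0} ->
  kappa <= h_min g * l_min g / (2 * (8 * h_max g + h_min g)) ->
  2 * kappa * h_max g <= gamma
    <= 1 / 2 * (h_min g * l_min g) - (h_min g + 6 * h_max g) * kappa ->
  let r := l_min g / 2 in
  [/\ 3 * kappa < r,
      {in jumps g &, forall t j, t != j -> 2 * r <= `|t - j|},
      {in jumps g, forall t, kappa * `|rval g t - lval g t| < gamma},
      {in jumps g, forall t, gamma < (r - 2 * kappa) * `|rval g t - lval g t|} &
      path (fun x y => x + 2 * r <= y) (0 - r) (rcons (jumps g) 1)].
Proof.
move=> k0 n0 jn0 kle /andP[gl gh] r.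
have hP : {in jumps g, forall t, h_min g <= `|rval g t - lval g t| <= h_max g}.
  move=> t tj; have th : `|rval g t - lval g t| \in jump_heights g by exact: map_f.
  by rewrite (seq_min_le th) (seq_max_ge th).
have hm0 : 0 < h_min g.
  apply: seq_min_gt0; first by rewrite size_map.
  by move=> _ /mapP[t tj ->]; rewrite normr_gt0 jn0.
have hmM : h_min g <= h_max g.
  have : (jumps g)`_0 \in jumps g by rewrite mem_nth.
  by move=> /hP/andP[]; exact: le_trans.
(* As [h_max g] is at least [h_min g], the denominator [2 * (8 * h_max g + h_min g)] is at least
   [18 * h_min g]. *)
have kl : 18 * kappa <= l_min g.
  have M0 : 0 <= kappa * (h_max g - h_min g) by apply: mulr_ge0; lra.
  rewrite -(ler_pM2l hm0); move: kle; rewrite ler_pdivlMr; lra.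
have lP : path (fun x y => x + 2 * r <= y) 0 (rcons (jumps g) 1).
  have -> : 2 * r = l_min g by rewrite /r; lra.
  by apply: path_lengths => d dl; exact: seq_min_le.
have kM : 0 < kappa * h_max g by apply: mulr_gt0; lra.
have km : 0 < kappa * h_min g by apply: mulr_gt0.
split.
- by rewrite /r; lra.
- apply: (@path_separated _ (2 * r) 0 (jumps g)); first by rewrite /r; lra.
  by move: lP; rewrite rcons_path => /andP[].
- move=> t /hP/andP[_ tM].
  have : kappa * `|rval g t - lval g t| <= kappa * h_max g by rewrite ler_pM2l.
  lra.
- move=> t /hP/andP[mt _].
  have H : (r - 2 * kappa) * h_min g <= (r - 2 * kappa) * `|rval g t - lval g t|.
    by rewrite ler_pM2l// /r; lra.
  apply: lt_le_trans H; rewrite /r.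
  have M0 : 0 <= kappa * (h_max g - h_min g) by apply: mulr_ge0; lra.
  lra.
(* The first jump is at distance at least [2 * r] from 0, and only [r] is required. *)
- move: lP; case: (jumps g) => [|t s] /= /andP[H pt]; apply/andP; split=> //;
    by move: H; rewrite /r; lra.
Qed.

Section PottsStep.
Variable R : realType.
Local Notation mu := (@lebesgue_measure R).

(** The energy is finite, so energies may be subtracted as real numbers. *)
Lemma potts_step (gamma : R) (theta : R -> R) (c : R) (h : R -> R) (s : seq R)
    (u : R -> R) (cu : R) (hu : R -> R) (su E : seq R) :
  nondecreasing_fun theta ->
  (forall x, x \notin E -> pc_extension u x = jump_sum (@heaviside R) cu hu su x) ->
  potts gamma (jump_sum theta c h s) u =
  (gamma * (nb_jumps u)%:R +
   \int[mu]_(x in `[0, 1]) `|jump_sum (@heaviside R) cu hu su x - jump_sum theta c h s x|)%:E.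
Proof.
move=> nd uE.
have I01 : integrable_on 0 1 (fun x =>
    `|jump_sum (@heaviside R) cu hu su x - jump_sum theta c h s x|).
  by apply: integrable_on_norm_sub; apply: integrable_on_jump_sum => //;
     exact: heaviside_nondecreasing.
rewrite /potts EFinD mulr_natr; congr (_ + _)%E.
rewrite /Rintegral fineK; last exact: (integrable_fin_num _ I01).
transitivity (\int[mu]_(x in `[0%R, 1%R])
    `|pc_extension u x - jump_sum theta c h s x|%:E)%E.
  apply: eq_integral => x; rewrite inE/= in_itv/= => /andP[x0 x1].
  by rewrite /pc_extension ltNge x0 ltNge x1.
apply: (@eq_off_integral _ _ E) => //.
  by apply/measurable_EFinP; exact: (measurable_int mu I01).
by move=> x /uE ->.
Qed.

Lemma ae_eq01_step (u v U V : R -> R) (E : seq R) :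
  integrable_on 0 1 (fun x => `|U x - V x|) ->
  \int[mu]_(x in `[0, 1]) `|U x - V x| = 0 ->
  (forall x, x \notin E -> pc_extension u x = U x /\ pc_extension v x = V x) ->
  ae_eq01 u v.
Proof.
move=> UVI UV0 uvE.
have mI : measurable (`[0, 1]%classic : set (measurableTypeR R)) by exact: measurable_itv.
have UVe : (\int[mu]_(x in `[0%R, 1%R]) `|(`|U x - V x|)%:E| = 0)%E.
  under eq_integral => x _.
    rewrite gee0_abs; last by rewrite lee_fin.
    over.
  by rewrite -[LHS]fineK ?(integrable_fin_num _ UVI)//; congr _%:E.
have [mE E0] := finite_lebesgue0 E.
have aeE : {ae mu, forall x : R, x \notin E}.
  by exists [set` E]; split => // x /= /negP; rewrite negbK.
have := (ae_eq_integral_abs mu mI (measurable_int mu UVI)).1 UVe.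
apply: (filterS2 _ _ aeE) => [|x xE H x01]; first exact: (ae_filter_ringOfSetsType mu).
have [uU vV] := uvE x xE.
have [] := H x01 => /normr0_eq0/subr0_eq.
move: uU vV; rewrite /pc_extension; move: x01; rewrite in_itv/= => /andP[x0 x1].
by rewrite ltNge x0 ltNge x1 /= => -> ->.
Qed.

End PottsStep.

(** * Minimality and uniqueness *)

Theorem theorem4p4 (R : realType) (g K : R -> R) (kappa : R)
  (hg : piecewise_constant g)
  (hK : convolution_kernel K)
  (kappa_gt0 : 0 < kappa)
  (hsupp : supp K `<=` `[- kappa, kappa])
  (hkappa : (0 < nb_jumps g)%N ->
     kappa <= h_min g * l_min g / (2 * (8 * h_max g + h_min g))) :
  let f := convolution K (pc_extension g) in
  forall gamma : R, 0 < gamma ->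
    ((0 < nb_jumps g)%N ->
       2 * kappa * h_max g <= gamma
         <= 1 / 2 * (h_min g * l_min g) - (h_min g + 6 * h_max g) * kappa) ->
    potts gamma f g = ereal_inf [set potts gamma f u | u in @piecewise_constant R]
    /\ (forall v, piecewise_constant v ->
          potts gamma f v
            = ereal_inf [set potts gamma f u | u in @piecewise_constant R] ->
          ae_eq01 v g).
Proof.
move=> f gamma gamma0 hgamma.
pose theta := cumulative_mass K.
have theta_nd : nondecreasing_fun theta := cumulative_mass_nondecreasing hK.
have theta_oppr := cumulative_mass_oppr hK.
have theta_left : forall y, y <= - kappa -> theta y = 0 := cumulative_mass_left hsupp.
have theta_lt := cumulative_mass_lt hK.
have [cg [Eg [sg jg gE]]] := pc_extension_step hg.
pose h t := rval g t - lval g t.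
pose G := jump_sum (@heaviside R) cg h (jumps g).
pose F := jump_sum theta cg h (jumps g).
have fE : f = F by apply/funext => x; exact: (convolution_jump_sum hK x gE).
have nd := @heaviside_nondecreasing R.
(* Comparing g with each competitor suffices: the infimum is then attained at g, and any other
   minimizer falls under the equality case. *)
have key u : piecewise_constant u -> (potts gamma f g <= potts gamma f u)%E /\
    (potts gamma f g = potts gamma f u -> ae_eq01 u g).
  move=> /pc_extension_step[cu [Eu [_ ju uE]]].
  rewrite fE (potts_step gamma cg h (jumps g) theta_nd gE).
  rewrite (potts_step gamma cg h (jumps g) theta_nd uE).
  pose hu t := rval u t - lval u t.
  pose U := jump_sum (@heaviside R) cu hu (jumps u).
  have UFI : integrable_on 0 1 (fun x => `|U x - F x|).
    by apply: integrable_on_norm_sub; exact: integrable_on_jump_sum.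
  have GFI : integrable_on 0 1 (fun x => `|G x - F x|).
    by apply: integrable_on_norm_sub; exact: integrable_on_jump_sum.
  suff [le eq] : gamma * (nb_jumps g)%:R <= gamma * (nb_jumps u)%:R +
        \int[@lebesgue_measure R]_(x in `[0, 1]) (`|U x - F x| - `|G x - F x|) /\
      (gamma * (nb_jumps g)%:R = gamma * (nb_jumps u)%:R +
        \int[@lebesgue_measure R]_(x in `[0, 1]) (`|U x - F x| - `|G x - F x|) ->
       \int[@lebesgue_measure R]_(x in `[0, 1]) `|U x - G x| = 0).
    move: le eq; rewrite (Rintegral_sub UFI GFI) => le eq.
    split; first by rewrite lee_fin -lerBrDr -addrA.
    move=> [E]; apply: (@ae_eq01_step R u g U G (Eu ++ Eg)).
    - by apply: integrable_on_norm_sub; exact: integrable_on_jump_sum.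
    - by apply: eq; rewrite addrA -E addrK.
    - by move=> x; rewrite mem_cat negb_or => /andP[xu xg]; split; [exact: uE|exact: gE].
  have [j0|j1] := posnP (nb_jumps g).
    rewrite j0 mulr0 (comparison_gap (h := h)); last 2 first.
    - exact: ler01.
    - by move=> x _; rewrite /jump_sum (size0nil j0) !big_nil.
    have d0 := @dist_ge0 R cg h (jumps g) cu hu (jumps u) 0 1.
    have k0 : 0 <= gamma * (nb_jumps u)%:R by exact: (mulr_ge0 (ltW gamma0) (ler0n _ _)).
    by split; lra.
  have jn0 : {in jumps g, forall t, h t != 0} by move=> t /jg[].
  have [kr sep lo hi pth] := potts_parameters kappa_gt0 j1 jn0 (hkappa j1) (hgamma j1).
  have us : uniq (jumps g) := sorted_uniq lt_trans ltxx sg.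
  (* All jumps lie strictly between 0 and 1, so the count that starts at [a = 0] misses none. *)
  have -> : nb_jumps u = count (fun t => (0 < t < 1)%R) (jumps u).
    by apply/esym/eqP; rewrite -all_count; apply/allP => t /ju[].
  apply: (@comparison _ _ _ kappa_gt0 theta_nd theta_oppr theta_left theta_lt
    cg h (jumps g) cu hu (jumps u) gamma _ kr gamma0 us jn0 sep lo hi 0 (jumps g) _ pth) => //.
  move=> x _ far.
  apply/esym/(jump_sum_far cg h kappa_gt0 theta_left).
    exact: (theta_right theta_oppr theta_left).
  by move=> t tj; apply: le_trans (far t tj); lra.
split.
  apply/eqP; rewrite eq_le; apply/andP; split.
    by apply: le_ereal_inf_tmp => _ [u /key[le _] <-].
  by apply: ereal_inf_lbound; exists g.
move=> v hv vE; have [le eq] := key v hv; apply: eq.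
apply/eqP; rewrite eq_le le vE /=; apply: ereal_inf_lbound; by exists g.
Qed.
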